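(* Let $k$ be an algebraically closed field of characteristic $3$. Let $f:S\to\mathbf{P}^1$ be a quasi-elliptic K3 surface with $10$ singular fibers of type $\mathrm{IV}$, given (up to birational equivalence over $\mathbf{P}^1$) by $y^2=x^3+a_{12}(t)$ with $$a_{12}(t)=t^{10}+a_8^3t^8+a_7^3t^7+a_5^3t^5+a_4^3t^4+t^2\qquad(a_4,a_5,a_7,a_8\in k),$$ where $a_{12}'(t)=0$ has only simple roots. Let $r$ be the Mordell--Weil torsion rank of $S$. Then $r\le4$. Moreover: (i) if $a_4a_8=1$, then $r\le3$; (ii) if $a_4a_8=1$ and $a_4^3+a_8=0$, then $r\le2$.
   Context: The quasi-elliptic surface is relatively minimal and has a section. The Mordell--Weil group $\mathrm{MW}(S)$ is the group of sections of $f$; with $u=x/y$, $v=1/y$ it is identified with the group of solutions $(u,v)\in k(t)^2$ of $u^3=v-a_{12}(t)v^3$ under componentwise addition. In characteristic $3$ one has $\mathrm{MW}(S)\cong(\mathbb{Z}/3\mathbb{Z})^r$, and $r$ is called the (Mordell--Weil) torsion rank. By a result of Ito, every quasi-elliptic K3 surface with $10$ singular fibers of type $\mathrm{IV}$ (and a section) over $\mathbf{P}^1$ in characteristic $3$ can be put in the form given in the claim. *)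

(* Defs.v *)
From mathcomp Require Import all_boot all_order all_algebra.
From mathcomp Require Import ring.

Set Implicit Arguments.
Unset Strict Implicit.
Unset Printing Implicit Defensive.

Import GRing.Theory.
Local Open Scope ring_scope.

(* Rational points of the projective Weierstrass cubic y^2 = x^3 + a. *)
Inductive wpoint (K : Type) := Inf | Aff of K & K.
Arguments Inf {K}.

Definition on_curve (K : fieldType) (a : K) (P : wpoint K) : Prop :=
  if P is Aff x y then y ^+ 2 = x ^+ 3 + a else True.

(* Chord-and-tangent law with neutral element the point at infinity.  The      *)
(* tangent slope at (x, y) is 3 x^2 / (2 y), which vanishes in characteristic  *)
(* 3.  The only excluded point of the quasi-elliptic cubic is its cusp y = 0,  *)
(* x^3 = -a; it is not rational when a is not a cube.                          *)
Definition wadd (K : fieldType) (P Q : wpoint K) : wpoint K :=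
  match P, Q with
  | Inf, _ => Q
  | _, Inf => P
  | Aff x1 y1, Aff x2 y2 =>
    if (x1 == x2) && (y1 == - y2) then Inf else
    let l := if x1 == x2 then 3%:R * x1 ^+ 2 / (2%:R * y1)
             else (y2 - y1) / (x2 - x1) in
    let x3 := l ^+ 2 - x1 - x2 in
    Aff x3 (- (y1 + l * (x3 - x1)))
  end.

(* A section of a relatively minimal fibration S -> P^1 is the same thing as a *)
(* k(t)-rational point of its generic fibre, and the generic fibre depends     *)
(* only on S up to birational equivalence over P^1.                            *)
Definition in_MW (k : fieldType) (a : {poly k}) :
    wpoint {fraction {poly k}} -> Prop :=
  on_curve (FracField.tofrac a).

(* MW(S) is isomorphic to (Z/3Z)^r. *)
Definition MW_torsion_rank (k : fieldType) (a : {poly k}) (r : nat) : Prop :=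
  exists phi : 'rV['F_3]_r -> wpoint {fraction {poly k}},
    [/\ injective phi,
        forall P, in_MW a P <-> exists w, phi w = P
      & forall w1 w2, phi (w1 + w2) = wadd (phi w1) (phi w2)].

Definition a12 (k : fieldType) (a4 a5 a7 a8 : k) : {poly k} :=
  'X^10 + (a8 ^+ 3) *: 'X^8 + (a7 ^+ 3) *: 'X^7 + (a5 ^+ 3) *: 'X^5
  + (a4 ^+ 3) *: 'X^4 + 'X^2.

(* The identification of the group of rational points with the additive group *)
(* of solutions of u^3 = v - a v^3, via u = x / y, v = 1 / y.                 *)
Definition uv (K : fieldType) (P : wpoint K) : K * K :=
  if P is Aff x y then (x / y, y^-1) else (0, 0).

Section UV.
Variables (K : fieldType) (a : K).
Hypothesis charK : 3%N \in [pchar K].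
Hypothesis a_noncube : forall x : K, x ^+ 3 != a.

Let three0 : 3%:R = 0 :> K. Proof. exact: pcharf0. Qed.

Lemma on_curve_neq0 x y : on_curve a (Aff x y) -> y != 0.
Proof.
move=> /= e; apply/eqP => y0; case/eqP: (a_noncube (- x)).
have -> : a = y ^+ 2 - x ^+ 3 by rewrite e; ring.
by rewrite y0; ring.
Qed.

Lemma uv_solution P : on_curve a P -> (uv P).1 ^+ 3 = (uv P).2 - a * (uv P).2 ^+ 3.
Proof.
case: P => [|x y] /= e; first by ring.
have y0 := on_curve_neq0 e.
have -> : a = y ^+ 2 - x ^+ 3 by rewrite e; ring.
by field.
Qed.

Lemma uv_surj u v : u ^+ 3 = v - a * v ^+ 3 ->
  exists2 P, on_curve a P & uv P = (u, v).
Proof.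
move=> e; have [v0|v0] := eqVneq v 0.
  exists Inf => //=; rewrite v0; congr (_, _).
  have /eqP : u ^+ 3 = 0 by rewrite e v0; ring.
  by rewrite expf_eq0 /= => /eqP.
exists (Aff (u / v) v^-1) => /=.
  have -> : (u / v) ^+ 3 = u ^+ 3 / v ^+ 3 by field.
  by rewrite e; field.
by rewrite invrK divfK.
Qed.

Lemma uv_inj P Q : on_curve a P -> on_curve a Q -> uv P = uv Q -> P = Q.
Proof.
case: P Q => [|x1 y1] [|x2 y2] //= e1 e2.
- by case=> _ /esym/eqP; rewrite invr_eq0 (negbTE (on_curve_neq0 e2)).
- by case=> _ /eqP; rewrite invr_eq0 (negbTE (on_curve_neq0 e1)).
case=> ex /invr_inj ey; rewrite -ey in ex *.
by rewrite (mulIf _ ex) // invr_eq0 (on_curve_neq0 e1).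
Qed.

Lemma cube_inj (x y : K) : x ^+ 3 = y ^+ 3 -> x = y.
Proof.
move=> e; apply/eqP; rewrite -subr_eq0; have : (x - y) ^+ 3 == 0.
  have -> : (x - y) ^+ 3 = x ^+ 3 - y ^+ 3 - 3%:R * (x ^+ 2 * y - x * y ^+ 2)
    by ring.
  by rewrite e three0 mul0r subrr subr0.
by rewrite expf_eq0.
Qed.

Lemma uv_wadd P Q : on_curve a P -> on_curve a Q ->
  uv (wadd P Q) = ((uv P).1 + (uv Q).1, (uv P).2 + (uv Q).2).
Proof.
case: P Q => [|x1 y1] [|x2 y2] e1 e2; rewrite /= ?add0r ?addr0 //.
have y10 := on_curve_neq0 e1; have y20 := on_curve_neq0 e2.
have [ex|nx] := eqVneq x1 x2; rewrite /=.
  have [ey|ny] := eqVneq y1 (- y2).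
    by rewrite /= ex ey invrN mulrN !addNr.
  have ey : y2 = y1.
    have : (y2 - y1) * (y2 + y1) == 0.
      have -> : (y2 - y1) * (y2 + y1) = y2 ^+ 2 - y1 ^+ 2 by ring.
      by rewrite /= in e1 e2; rewrite e1 e2 ex subrr.
    rewrite mulf_eq0 => /orP[|]; first by rewrite subr_eq0 => /eqP.
    by rewrite addrC addr_eq0 (negbTE ny).
  rewrite /= three0 !mul0r -ex ey.
  have -> : x1 / y1 + x1 / y1 = 3%:R * (x1 / y1) - x1 / y1 by ring.
  have -> : y1^-1 + y1^-1 = 3%:R * y1^-1 - y1^-1 by ring.
  have -> : 0 ^+ 2 - x1 - x1 = x1 - 3%:R * x1 by ring.
  by rewrite three0 !mul0r !sub0r subr0 addr0 invrN mulrN.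
have ys0 : y1 + y2 != 0.
  apply: contra nx; rewrite addr_eq0 => /eqP ey; apply/eqP/cube_inj.
  rewrite /= in e1 e2; have : y1 ^+ 2 = y2 ^+ 2 by rewrite ey sqrrN.
  by rewrite e1 e2 => /addIr.
have nx' : x2 - x1 != 0 by rewrite subr_eq0 eq_sym.
have dx3 : (x2 - x1) ^+ 3 = (y2 - y1) * (y1 + y2).
  rewrite /= in e1 e2.
  have -> : (y2 - y1) * (y1 + y2) = y2 ^+ 2 - y1 ^+ 2 by ring.
  rewrite e1 e2.
  have -> : (x2 - x1) ^+ 3 = x2 ^+ 3 - x1 ^+ 3 - 3%:R * (x2 ^+ 2 * x1 - x2 * x1 ^+ 2)
    by ring.
  by rewrite three0; ring.
set l := (y2 - y1) / (x2 - x1).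
have l2 : l ^+ 2 = (y2 - y1) * (x2 - x1) / (y1 + y2).
  apply: (mulIf (expf_neq0 3 nx')); rewrite [in RHS]dx3 /l; by field; rewrite ?nx' ?ys0.
have hx : l ^+ 2 - x1 - x2 = (x1 * y2 + x2 * y1) / (y1 + y2).
  rewrite l2.
  have -> : (y2 - y1) * (x2 - x1) / (y1 + y2) - x1 - x2
    = (x1 * y2 + x2 * y1) / (y1 + y2)
      - 3%:R * ((x1 * y2 + x2 * y1) / (y1 + y2)) by field.
  by rewrite three0 mul0r subr0.
rewrite hx.
have -> : y1 + l * ((x1 * y2 + x2 * y1) / (y1 + y2) - x1)
    = 3%:R * (y1 * y2 / (y1 + y2)) - y1 * y2 / (y1 + y2) +
      (y1 + y2 - y1 - y2).
  by rewrite /l; field; rewrite ?nx' ?ys0.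
have -> : y1 + y2 - y1 - y2 = 0 by ring.
rewrite three0 mul0r sub0r addr0 opprK.
by congr (_, _); field; rewrite ?y10 ?y20 ?ys0.
Qed.

End UV.

(* Main.v *)
Require Import Defs.
From mathcomp Require Import all_boot all_order all_algebra.
From mathcomp Require Import generic_quotient ring zify.
From Stdlib Require Import Classical.

(** Rational points of y^2 = x^3 + a(t) correspond to solutions over k(t) of
    u^3 = v - a v^3, and differentiating this equation in characteristic 3 gives
    v' = a' v^3.  Write D = a'.  The last equation forces the denominator of v
    to divide D, so w = D v is a polynomial, and it satisfies
    w^3 = w' D - w D' ([clear_denominators]).  As D has degree 9 and D' has degree
    at most 6, comparing degrees gives deg w <= 4 ([size_solution]).

    Since w^3 = sum_i w_i^3 t^(3i), comparing coefficients turns the equation for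
    w into a Frobenius-linear system ([coef_solution]): w_2 = 0 and, with
    b_i = a_i^3,
      w_0^3 = w_0,                        w_4^3 = w_4,
      w_1^3 = b_4 w_1 + w_3 + b_5 w_0,    w_3^3 = w_1 + b_8 w_3 + b_7 w_4.
    The first two equations put w_0 and w_4 in F_3, and w_1 determines w_3.  Given
    w_0 and w_4, eliminating w_3 leaves a monic equation of degree 9 for w_1, so
    there are at most 9 * 9 = 3^4 solutions.  If a_4 a_8 = 1 the linear part drops
    rank: w_1 and w_3 are both determined by w_0, w_4 and z = b_4 w_1 + w_3, which
    satisfies
      z^3 = (a_4^3 + a_8)^3 z + (terms in w_0 and w_4).
    So there are at most 9 * 3 = 3^3 solutions, and only 9 = 3^2 when moreover
    a_4^3 + a_8 = 0, because z is then determined by w_0 and w_4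
    ([card_solutions]).

    Finally, a subgroup of exponent 3 containing no more than 3^N points is a
    finite-dimensional F_3-vector space ([elementary_abelian3_coordinates]), so
    the rank exists and the counts bound it. *)

Set Implicit Arguments.
Unset Strict Implicit.
Unset Printing Implicit Defensive.

Import GRing.Theory.
Local Open Scope ring_scope.

(** * Cubes and fractions in characteristic 3 *)

Lemma mulrn_mod3 (R : nzRingType) (charR : 3%N \in [pchar R]) (x : R) n :
  x *+ n = x *+ (n %% 3).
Proof. by rewrite -mulr_natr -(GRing.natr_mod_pchar charR) mulr_natr. Qed.

Lemma cubeD (R : comNzRingType) (charR : 3%N \in [pchar R]) (x y : R) :
  (x + y) ^+ 3 = x ^+ 3 + y ^+ 3.
Proof. by apply: exprDn_pchar; rewrite pnatE. Qed.

Lemma pchar_fraction_poly (F : fieldType) p :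
  p \in [pchar F] -> p \in [pchar {fraction {poly F}}].
Proof.
move=> charF.
apply: (rmorph_pchar (@FracField.tofrac {poly F})).
by rewrite pchar_poly.
Qed.

Lemma deriv_cube (R : comNzRingType) (charR : 3%N \in [pchar R]) (p : {poly R}) :
  (p ^+ 3)^`() = 0.
Proof.
by rewrite deriv_exp mulrn_mod3 ?mulr0n // pchar_poly.
Qed.

(** Coefficientwise form of the Frobenius: cubing a polynomial cubes the
    coefficients and triples the exponents. *)
Lemma coef_cube (R : comNzRingType) (charR : 3%N \in [pchar R]) (p : {poly R}) i :
  (p ^+ 3)`_i = if (3 %| i)%N then p`_(i %/ 3) ^+ 3 else 0.
Proof.
have charP : 3%N \in [pchar {poly R}] by rewrite pchar_poly.
elim/poly_ind: p i => [|p c IH] i; first by rewrite expr0n /= !coef0 expr0n if_same.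
rewrite cubeD // exprMn coefD coefMXn -rmorphXn coefC.
case: i => [|[|[|i]]] //=; try by rewrite addr0.
  by rewrite coefD coefMX coefC /= !add0r.
rewrite addr0 !subSS subn0.
rewrite IH (@dvdn_addr 3 3 i) // (@divnMDl 1 i 3) //.
case: ifP => // _.
by rewrite coefD coefMX coefC /= addr0.
Qed.

(** Lowest terms, with the denominator cleared so that the equation can be moved
    back to polynomials. *)
Lemma fraction_polyP (F : fieldType) (x : {fraction {poly F}}) :
  exists p q : {poly F}, [/\ q != 0, coprimep q p &
    x * FracField.tofrac q = FracField.tofrac p].
Proof.
have [n [d [d0 nd]]] : exists n d : {poly F}, d != 0 /\
    x * FracField.tofrac d = FracField.tofrac n.
  exists (frac (repr x)).1, (frac (repr x)).2; split; first exact: denom_ratioP.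
  rewrite -{1}[x]reprK; unlock FracField.tofrac; rewrite -[_ * _]FracField.pi_mul.
  apply/eqP; rewrite piE /= FracField.equivfE /FracField.mulf.
  rewrite !numden_Ratio ?mulr1 ?oner_neq0 ?denom_ratioP //.
  by rewrite mulrC.
have g0 : gcdp n d != 0 by rewrite gcdp_eq0 negb_and d0 orbT.
exists (n %/ gcdp n d), (d %/ gcdp n d); split.
- by rewrite dvdp_div_eq0 // dvdp_gcdr.
- by rewrite coprimep_sym coprimep_div_gcd // d0 orbT.
apply: (@mulIf _ (FracField.tofrac (gcdp n d))); first by rewrite tofrac_eq0.
by rewrite -mulrA -!tofracM !divpK ?dvdp_gcdl ?dvdp_gcdr.
Qed.

(** * From solutions over k(t) to polynomials of degree at most 4 *)

(** Writing v = p / q in lowest terms, v' = a' v^3 reads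
    q (p' q - p q') = a' p^3, so q divides a'.  The equation for w = a' v is
    v' = a' v^3 multiplied by a'^2. *)
Lemma clear_denominators (F : fieldType) (charF : 3%N \in [pchar F])
    (a : {poly F}) (u v : {fraction {poly F}}) :
  u ^+ 3 = v - FracField.tofrac a * v ^+ 3 ->
  exists w, FracField.tofrac a^`() * v = FracField.tofrac w /\
    w ^+ 3 = w^`() * a^`() - w * a^`()^`().
Proof.
move=> sol.
have three0 : 3%:R = 0 :> {poly F} by apply: pcharf0; rewrite pchar_poly.
have [r [s [s0 _ us]]] := fraction_polyP u.
have [p [q [q0 co vq]]] := fraction_polyP v.
have E : (r * q) ^+ 3 = s ^+ 3 * (p * q ^+ 2 - a * p ^+ 3).
  apply/eqP; rewrite -tofrac_eq; apply/eqP.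
  rewrite !(rmorphXn, rmorphM, rmorphB) /= -us -vq.
  ring: sol.
(* The left-hand side of E is a cube, so the second factor on its right has
   zero derivative; modulo 3 this is v' = a' v^3. *)
have dE : q * (p^`() * q - p * q^`()) = a^`() * p ^+ 3.
  have : (s ^+ 3 * (p * q ^+ 2 - a * p ^+ 3))^`() = 0 by rewrite -E deriv_cube.
  rewrite derivM deriv_cube // mul0r add0r => /eqP.
  rewrite mulf_eq0 expf_eq0 (negbTE s0) /= => /eqP.
  rewrite derivB (derivM a) deriv_cube // (derivM p) deriv_exp /= mulr0 addr0 => h.
  apply/eqP; rewrite -subr_eq0; apply/eqP.
  rewrite -[RHS](subrr 0) -{1}h -{1}(mul0r (p * q * q^`())) -three0.
  ring.
have /dvdpP[e De] : q %| a^`().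
  by rewrite -(Gauss_dvdpl _ (coprimep_expr 3 co)) -dE dvdp_mulr.
exists (p * e); split.
  by rewrite De !rmorphM /= -vq; ring.
have e3 : e * p ^+ 3 = p^`() * q - p * q^`().
  by apply: (mulfI q0); rewrite dE De; ring.
rewrite De !derivM.
have -> : (p * e) ^+ 3 = e ^+ 2 * (e * p ^+ 3) by ring.
by rewrite e3; ring.
Qed.

Lemma a12_deriv (F : fieldType) (charF : 3%N \in [pchar F]) (a4 a5 a7 a8 : F) :
  (a12 a4 a5 a7 a8)^`() = 'X^9 - a8 ^+ 3 *: 'X^7 + a7 ^+ 3 *: 'X^6
    - a5 ^+ 3 *: 'X^4 + a4 ^+ 3 *: 'X^3 - 'X.
Proof.
have charP : 3%N \in [pchar {poly F}] by rewrite pchar_poly.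
rewrite /a12 !derivD !derivZ !derivXn /=.
rewrite !(mulrn_mod3 charP _ 10, mulrn_mod3 charP _ 8, mulrn_mod3 charP _ 7,
  mulrn_mod3 charP _ 5, mulrn_mod3 charP _ 4) /=.
have m2 (x : {poly F}) : x *+ 2 = - x.
  by apply/eqP; rewrite -addr_eq0 -mulrSr mulrn_mod3.
by rewrite ?mulr1n !m2 expr1 !scalerN.
Qed.

Lemma a12_deriv2 (F : fieldType) (charF : 3%N \in [pchar F]) (a4 a5 a7 a8 : F) :
  (a12 a4 a5 a7 a8)^`()^`() = - (a8 ^+ 3 *: 'X^6) - a5 ^+ 3 *: 'X^3 - 1.
Proof.
have charP : 3%N \in [pchar {poly F}] by rewrite pchar_poly.
rewrite a12_deriv // !(derivD, derivN, derivZ, derivXn, derivX) /=.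
rewrite !(mulrn_mod3 charP _ 9, mulrn_mod3 charP _ 7, mulrn_mod3 charP _ 6,
  mulrn_mod3 charP _ 4, mulrn_mod3 charP _ 3) /=.
by rewrite !(mulr0n, mulr1n, scaler0, addr0, add0r).
Qed.

(** If deg w = m, the left-hand side has degree 3 m and the right-hand side at
    most m + 8, as a12' has degree 9 and a12'' degree at most 6. *)
Lemma size_solution (F : fieldType) (charF : 3%N \in [pchar F])
    (a4 a5 a7 a8 : F) (D := (a12 a4 a5 a7 a8)^`()) (w : {poly F}) :
  w ^+ 3 = w^`() * D - w * D^`() -> (size w <= 5)%N.
Proof.
move=> e; have [->|w0] := eqVneq w 0; first by rewrite size_poly0.
have szD : (size D <= 10)%N.
  apply/leq_sizeP => j hj; rewrite /D a12_deriv // !coefE.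
  by rewrite !gtn_eqF ?(leq_trans _ hj) // !(mulr0, subr0, addr0).
have szD' : (size D^`() <= 7)%N.
  apply/leq_sizeP => j hj; rewrite /D a12_deriv2 // !coefE.
  by rewrite !gtn_eqF ?(leq_trans _ hj) // !(mulr0, subr0, oppr0).
have sizeM (p q : {poly F}) m n :
    (size p <= m)%N -> (size q <= n)%N -> (size (p * q)%R <= (m + n).-1)%N.
  move=> hp hq; apply: leq_trans (size_polyMleq _ _) _.
  by rewrite -!subn1 leq_sub2r // leq_add.
have := lt_size_deriv w0; have := size_exp w 3.
case sz: (size w) => [|m] // szw3; rewrite ltnS => szw'.
have szw : (size w <= m.+1)%N by rewrite sz.
have : (size (w ^+ 3)%R <= m + 9)%N.
  rewrite e (leq_trans (size_polyD _ _)) // geq_max size_polyN.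
  rewrite (leq_trans (sizeM _ _ _ _ szw' szD)) ?addnS ?leqnn //=.
  by apply: leq_trans (sizeM _ _ _ _ szw szD') _; lia.
by rewrite -ltnS; case: (size (w ^+ 3)) szw3 => [|s] /= e3; lia.
Qed.

(** The five conclusions come from the coefficients of t^0, t^12, t^3, t^9 and
    t^2 respectively; the last of these vanishes in w^3. *)
Lemma coef_solution (F : fieldType) (charF : 3%N \in [pchar F])
    (a4 a5 a7 a8 : F) (D := (a12 a4 a5 a7 a8)^`()) (w : {poly F}) :
  w ^+ 3 = w^`() * D - w * D^`() ->
  [/\ w`_0%N ^+ 3 = w`_0%N, w`_4%N ^+ 3 = w`_4%N,
      w`_1%N ^+ 3 = a4 ^+ 3 * w`_1%N + w`_3%N + a5 ^+ 3 * w`_0%N,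
      w`_3%N ^+ 3 = w`_1%N + a8 ^+ 3 * w`_3%N + a7 ^+ 3 * w`_4%N
    & w`_2%N = 0].
Proof.
move=> e; have szw := size_solution charF e.
have hi i : (5 <= i)%N -> w`_i = 0.
  by move=> h; apply: nth_default; apply: leq_trans szw h.
have ei i : (if (3 %| i)%N then w`_(i %/ 3) ^+ 3 else 0)
   = (w^`() * D - w * D^`())`_i by rewrite -coef_cube // e.
rewrite /D a12_deriv2 // a12_deriv // in ei.
have m2 (x : F) : x *+ 2 = - x.
  by apply/eqP; rewrite -addr_eq0 -mulrSr mulrn_mod3.
have m3 (x : F) : x *+ 3 = 0 by rewrite mulrn_mod3.
have m4 (x : F) : x *+ 4 = x by rewrite mulrn_mod3.
move: (ei 0%N) (ei 2%N) (ei 3%N) (ei 9%N) (ei 12%N).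
rewrite !(mulrDr, mulrN, mulr1, coefB, coefD, coefN) -!scalerAr !(coefZ, coefMXn, coefMX) /=.
rewrite !coef_deriv !subSS ?subn0 /=.
rewrite !(hi 5%N, hi 6%N, hi 7%N, hi 9%N, hi 12%N, hi 10%N) //.
rewrite !(m2, m3, m4, mulr1n, mul0rn).
move=> e0 e2 e3 e9 e12; split.
- by rewrite [LHS]e0; ring.
- by rewrite [LHS]e12; ring.
- by rewrite [LHS]e3; ring.
- by rewrite [LHS]e9; ring.
- by apply: oppr_inj; rewrite oppr0 [RHS]e2 -[LHS]m2; ring.
Qed.

(** * Counting *)

Lemma roots_seq (k : closedFieldType) (p : {poly k}) : p != 0 ->
  {rs : seq k | size rs = (size p).-1 & forall x, root p x -> x \in rs}.
Proof.
have [rs def_p] := closed_field_poly_normal p => p0; exists rs.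
  rewrite def_p size_scale ?lead_coef_eq0 // size_prod_XsubC //.
by move=> x; rewrite def_p rootZ ?lead_coef_eq0 // root_prod_XsubC.
Qed.

(** A triangular system: two coordinates in F_3, and a third one that is a root
    of a monic polynomial of degree n depending on them.  The list q x y holds
    the coefficients of the lower-order terms, moved to the right-hand side. *)
Lemma card_triangular (k : closedFieldType) (T : finType) (f : T -> k * k * k)
    (n : nat) (q : k -> k -> seq k) :
  injective f -> (0 < n)%N ->
  (forall x y, size (q x y) <= n)%N ->
  (forall t, [/\ (f t).1.1 ^+ 3 = (f t).1.1, (f t).1.2 ^+ 3 = (f t).1.2
     & (f t).2 ^+ n = (Poly (q (f t).1.1 (f t).1.2)).[(f t).2]]) ->
  (#|T| <= 9 * n)%N.
Proof.
move=> inj_f n0 sq hf.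
have rootsP (m : nat) (s : seq k) : (0 < m)%N -> (size s <= m)%N ->
    {rs : seq k | size rs = m & forall x, x ^+ m = (Poly s).[x] -> x \in rs}.
  move=> m0 ss; have szp : size ('X^m - Poly s) = m.+1.
    by rewrite size_polyDl ?size_polyXn // size_polyN ltnS (leq_trans (size_Poly s)).
  have [|rs srs rsP] := @roots_seq k ('X^m - Poly s).
    by rewrite -size_poly_eq0 szp.
  exists rs; first by rewrite srs szp.
  by move=> x hx; apply: rsP; rewrite /root hornerD hornerN hornerXn hx subrr.
(* [:: 0; 1] lists the coefficients of the right-hand side of x^3 = x. *)
have [F3 sF3 F3P] := rootsP 3%N [:: 0; 1] isT isT.
have memF3 x : x ^+ 3 = x -> x \in F3.
  by move=> hx; apply: F3P; rewrite hx /= !cons_poly_def mul0r add0r; rewrite ?hornerE.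
have rtP xy := rootsP n (q xy.1 xy.2) n0 (sq _ _).
pose L := [seq (xy, z) | xy <- [seq (x, y) | x <- F3, y <- F3],
                         z <- s2val (rtP xy)].
have sL : size L = (9 * n)%N.
  rewrite size_allpairs_dep sumnE big_map.
  rewrite (eq_bigr (fun=> n)) => [|xy _]; last by case: (rtP xy).
  by rewrite big_const_seq count_predT iter_addn_0 size_allpairs sF3 mulnC.
rewrite cardE -(size_map f) -sL; apply: uniq_leq_size.
  by rewrite map_inj_uniq ?enum_uniq.
move=> _ /mapP[t _ ->]; have [h1 h2 h3] := hf t.
case: (f t) h1 h2 h3 => [[x y] z] /= h1 h2 h3.
apply/allpairsPdep; exists (x, y), z; split=> //.
  by apply/allpairsP; exists (x, y); split; rewrite ?memF3.
by case: (rtP (x, y)) => rt _ /=; apply.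
Qed.

(** Only the third coordinate depends on the case: w_1 in general, the
    combination z = a4^3 w_1 + w_3 when a4 a8 = 1, and a constant when z is
    already determined by w_0 and w_4. *)
Lemma card_solutions (k : closedFieldType) (chark : 3%N \in [pchar k])
    (a4 a5 a7 a8 : k) (D := (a12 a4 a5 a7 a8)^`())
    (T : finType) (w : T -> {poly k}) :
  injective w -> (forall t, w t ^+ 3 = (w t)^`() * D - w t * D^`()) ->
  [/\ (#|T| <= 81)%N, (a4 * a8 = 1 -> (#|T| <= 27)%N)
    & (a4 * a8 = 1 -> a4 ^+ 3 + a8 = 0 -> (#|T| <= 9)%N)].
Proof.
move=> inj_w solw; have cubeE := cubeD chark.
have size_w t := size_solution chark (solw t).
have coef_w t := coef_solution chark (solw t).
have eq_w s t : (w s)`_0%N = (w t)`_0%N -> (w s)`_4%N = (w t)`_4%N ->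
    (w s)`_1%N = (w t)`_1%N -> (w s)`_3%N = (w t)`_3%N -> s = t.
  move=> e0 e4 e1 e3; apply/inj_w/polyP => -[|[|[|[|[|i]]]]] //.
    by have [_ _ _ _ ->] := coef_w s; have [_ _ _ _ ->] := coef_w t.
  by rewrite !nth_default // (leq_trans (size_w _)).
(* When a4 a8 = 1, a8^3 z is the linear part w_1 + a8^3 w_3 of the equation for
   w_3^3, while z itself is that of the equation for w_1^3. *)
pose z t := a4 ^+ 3 * (w t)`_1%N + (w t)`_3%N.
have inj_z s t : (w s)`_0%N = (w t)`_0%N -> (w s)`_4%N = (w t)`_4%N ->
    z s ^+ 3 = z t ^+ 3 -> s = t.
  move=> e0 e4 /(cube_inj chark) ez.
  have e1 : (w s)`_1%N = (w t)`_1%N.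
    apply: (cube_inj chark); have [_ _ -> _ _] := coef_w s.
    by have [_ _ -> _ _] := coef_w t; rewrite -!/(z _) ez e0.
  by apply: eq_w => //; apply: (addrI (a4 ^+ 3 * (w s)`_1%N)); rewrite {2}e1.
have z_cube t : a4 * a8 = 1 -> z t ^+ 3 = (a4 ^+ 3 + a8) ^+ 3 * z t
    + ((a4 ^+ 3) ^+ 3 * a5 ^+ 3 * (w t)`_0%N + a7 ^+ 3 * (w t)`_4%N).
  move=> a48; have [_ _ c1 c3 _] := coef_w t.
  rewrite /z !cubeE exprMn c1 c3.
  ring: a48.
split=> [|a48|a48 a0].
- apply: (@card_triangular k T (fun t => ((w t)`_0%N, (w t)`_4%N, (w t)`_1%N)) 9
    (fun x y => [:: (a5 ^+ 3) ^+ 3 * x - a8 ^+ 3 * a5 ^+ 3 * x + a7 ^+ 3 * y;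
                    1 - a8 ^+ 3 * a4 ^+ 3; 0; (a4 ^+ 3) ^+ 3 + a8 ^+ 3])) => //.
    (* w_3 is recovered from w_0 and w_1 by the equation for w_1^3. *)
    move=> s t [e0 e4 e1]; apply: eq_w => //.
    have [_ _ c1 _ _] := coef_w s; have [_ _ c1' _ _] := coef_w t.
    by move: c1; rewrite e1 c1' e0 => /addIr/addrI/esym.
  move=> t; have [c0 c4 c1 c3 _] := coef_w t; split => //=.
  rewrite !cons_poly_def !hornerE /=.
  (* w_1^9 = (w_1^3)^3: cube the equation for w_1^3, then replace w_3^3. *)
  rewrite (exprM _ 3 3) c1 !cubeE !exprMn c0 c3.
  ring: c1.
- apply: (@card_triangular k T (fun t => ((w t)`_0%N, (w t)`_4%N, z t)) 3
    (fun x y => [:: (a4 ^+ 3) ^+ 3 * a5 ^+ 3 * x + a7 ^+ 3 * y;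
                    (a4 ^+ 3 + a8) ^+ 3])) => //.
    by move=> s t [e0 e4 ez]; apply: inj_z; rewrite ?ez.
  move=> t; have [c0 c4 _ _ _] := coef_w t; split => //=.
  by rewrite !cons_poly_def !hornerE /= z_cube //; ring.
- rewrite -[9%N]/(9 * 1)%N.
  apply: (@card_triangular k T (fun t => ((w t)`_0%N, (w t)`_4%N, 0)) 1
    (fun _ _ => [::])) => //.
    move=> s t [e0 e4]; apply: inj_z => //.
    by rewrite !z_cube // a0 expr0n !mul0r e0 e4.
  by move=> t; have [c0 c4 _ _ _] := coef_w t; split; rewrite //= horner0.
Qed.

(** * Coordinates on groups of exponent 3 *)

(** Maximality: an embedded F_3^r that misses an element x of S extends to an
    embedded F_3^(r+1) by sending the new coordinate to x, and the bound N stops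
    this process. *)
Lemma elementary_abelian3_coordinates (V : zmodType) (S : V -> Prop) (N : nat) :
  (forall x : V, x *+ 3 = 0) -> S 0 -> (forall x y, S x -> S y -> S (x + y)) ->
  (forall r (phi : 'rV['F_3]_r -> V),
     injective phi -> (forall w, S (phi w)) -> (r <= N)%N) ->
  exists r (phi : 'rV['F_3]_r -> V),
    [/\ injective phi, forall x, S x <-> exists w, phi w = x
      & forall w1 w2, phi (w1 + w2) = phi w1 + phi w2].
Proof.
move=> tors3 S0 SD bounded.
pose embeds r (phi : 'rV['F_3]_r -> V) := [/\ injective phi,
  forall w, S (phi w) & forall w1 w2, phi (w1 + w2) = phi w1 + phi w2].
have extend r (phi : 'rV['F_3]_r -> V) x : embeds r phi -> S x ->
    ~ (exists w, phi w = x) -> exists psi, embeds r.+1 psi.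
  move=> [inj_phi Sphi phiD] Sx notin.
  have phi0 : phi 0 = 0 by apply: (addrI (phi 0)); rewrite -phiD !addr0.
  have phiN w : phi (- w) = - phi w.
    by apply: (addrI (phi w)); rewrite -phiD !subrr.
  have mod3 n : x *+ (n %% 3) = x *+ n.
    by rewrite {2}(divn_eq n 3) mulrnDr mulnC mulrnA tors3 mul0rn add0r.
  pose psi (w : 'rV['F_3]_(1 + r)) :=
    x *+ (lsubmx w 0 0 : 'F_3) + phi (rsubmx w).
  have psiD w1 w2 : psi (w1 + w2) = psi w1 + psi w2.
    rewrite /psi !linearD /= phiD addrACA; congr (_ + _).
    by rewrite mxE -mulrnDr -[RHS]mod3.
  (* If the new coordinate c of a kernel element were 1 or 2, then x or
     2 x = - x would be in the image of phi, hence so would x. *)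
  have psi_eq0 (w : 'rV['F_3]_(1 + r)) : psi w = 0 -> w = 0.
    rewrite /psi => eq0; have [c ltc cE] :
        exists2 c, (c < 3)%N & nat_of_ord (lsubmx w 0 0 : 'F_3) = c.
      by exists (lsubmx w 0 0 : 'F_3) => //; apply: ltn_ord.
    rewrite cE in eq0; case: c ltc cE eq0 => [|[|[|//]]] _ cE eq0.
    - rewrite mulr0n add0r -phi0 in eq0.
      rewrite -[w]hsubmxK (inj_phi _ _ eq0).
      rewrite [lsubmx w](_ : _ = 0) ?row_mx0 //.
      by apply/matrixP => i j; rewrite !ord1 [RHS]mxE; apply: val_inj.
    - case: notin; exists (- rsubmx w).
      by rewrite phiN; apply/esym/eqP; rewrite -addr_eq0 eq0.
    - case: notin; exists (rsubmx w).
      by apply: (addrI (x *+ 2)); rewrite eq0 -mulrSr tors3.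
  exists psi; split=> [w1 w2 eq_psi|w|w1 w2]; last exact: psiD.
    apply/eqP; rewrite -subr_eq0; apply/eqP/psi_eq0.
    by apply: (addIr (psi w2)); rewrite -psiD subrK add0r.
  apply: (SD) => //; elim: (nat_of_ord _) => [|n IH]; first by rewrite mulr0n.
  by rewrite mulrS; apply: (SD).
(* Induction on the number n of dimensions left before the bound is exceeded. *)
have step n r (phi : 'rV['F_3]_r -> V) : embeds r phi -> (N < n + r)%N ->
    exists r' (psi : 'rV['F_3]_r' -> V),
      embeds r' psi /\ forall x, S x -> exists w, psi w = x.
  elim: n r phi => [|n IH] r phi ephi ltN.
    by case: ephi => [inj_phi Sphi _]; have := bounded r phi inj_phi Sphi; lia.
  have [surj|] := classic (forall x, S x -> exists w, phi w = x).
    by exists r, phi.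
  case/not_all_ex_not => x /(@imply_to_and (S x))[Sx notin].
  have [psi epsi] := extend r phi x ephi Sx notin.
  by apply: (IH r.+1 psi epsi); rewrite addnS -addSn.
have [||r [phi [[inj_phi Sphi phiD] surj]]] := step N.+1 0%N (fun=> 0).
- split=> [w1 w2 _|//|w1 w2]; first by rewrite [w1]thinmx0 [w2]thinmx0.
  by rewrite addr0.
- by rewrite addn0.
- exists r, phi; split=> // x; split=> [/surj//|[w <-]]; exact: Sphi.
Qed.

(** * The Mordell-Weil group *)

(** [uv_inj] needs both points on the curve.  That the chord construction yields
    a point of the curve is obtained here from [uv] alone: a point with y != 0
    is determined by its image, and a sum with y = 0 would have coordinates (0, 0), so that Q
    would be the opposite of P and the sum the point at infinity. *)
Lemma uv_wadd_inj (K : fieldType) (a : K) (P Q R : wpoint K) :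
  3%N \in [pchar K] -> (forall x : K, x ^+ 3 != a) ->
  on_curve a P -> on_curve a Q -> on_curve a R ->
  uv (wadd P Q) = uv R -> wadd P Q = R.
Proof.
move=> charK noncube onP onQ onR eR.
have := uv_wadd charK noncube onP onQ; move: eR.
case: P Q onP onQ => [|x1 y1] [|x2 y2] onP onQ; try by move=> eR _; apply: (uv_inj noncube).
rewrite /wadd; case: ifP => [_ eR _|opp eR sum]; first exact: (uv_inj noncube).
case: R onR eR => [|x y] onR eR; last first.
  have y0 := on_curve_neq0 noncube onR.
  by case: eR => e1 /invr_inj e2; move: e1; rewrite e2 => /(mulIf (invr_neq0 y0)) ->.
move: sum; rewrite eR => -[/esym/eqP + /esym/eqP].
rewrite !addr_eq0 -invrN => + /eqP/invr_inj ey.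
have y20 := on_curve_neq0 noncube onQ.
rewrite ey invrN mulrN eqr_opp => /eqP/(mulIf (invr_neq0 y20)) ex.
by rewrite ex ey !eqxx in opp.
Qed.

Section Solutions.

Variables (k : closedFieldType) (a4 a5 a7 a8 : k).
Hypothesis chark : 3%N \in [pchar k].

Let a : {poly k} := a12 a4 a5 a7 a8.
Let K := {fraction {poly k}}.
Let charK : 3%N \in [pchar K] := pchar_fraction_poly chark.

Lemma a12_deriv_neq0 : a^`() != 0.
Proof.
apply/eqP => /(congr1 (fun p : {poly k} => p`_9%N)) /eqP.
rewrite a12_deriv // !coefE /= !(mulr0, subr0, addr0).
by rewrite oner_eq0.
Qed.

(** If x = p / q, then p^3 = a q^3 has zero derivative, which is a' q^3. *)
Lemma a12_noncube (x : K) : x ^+ 3 != FracField.tofrac a.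
Proof.
apply/eqP => ex; have [p [q [q0 _ xq]]] := fraction_polyP x.
have e : p ^+ 3 = a * q ^+ 3.
  by apply/eqP; rewrite -tofrac_eq !(rmorphXn, rmorphM) /= -xq exprMn ex.
have := deriv_cube chark p; rewrite e derivM deriv_cube // mulr0 addr0 => /eqP.
by rewrite mulf_eq0 expf_eq0 (negbTE q0) (negbTE a12_deriv_neq0).
Qed.

Definition uv_eq (s : K * K) := s.1 ^+ 3 = s.2 - FracField.tofrac a * s.2 ^+ 3.

Lemma uv_eqD s t : uv_eq s -> uv_eq t -> uv_eq (s + t).
Proof. by rewrite /uv_eq /= !(cubeD charK) => -> ->; ring. Qed.

Lemma card_uv_eq (T : finType) (f : T -> K * K) :
  injective f -> (forall t, uv_eq (f t)) ->
  [/\ (#|T| <= 81)%N, (a4 * a8 = 1 -> (#|T| <= 27)%N)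
    & (a4 * a8 = 1 -> a4 ^+ 3 + a8 = 0 -> (#|T| <= 9)%N)].
Proof.
move=> inj_f sol_f.
have /fin_all_exists[w wP] t := clear_denominators chark (sol_f t).
apply: (@card_solutions k chark a4 a5 a7 a8 T w) => [s t eq_w|t]; last first.
  by have [_] := wP t.
have [ws _] := wP s; have [wt _] := wP t.
have e2 : (f s).2 = (f t).2.
  apply: (@mulfI _ (FracField.tofrac a^`())).
    by rewrite tofrac_eq0 a12_deriv_neq0.
  by rewrite ws wt eq_w.
apply: inj_f; rewrite [f s]surjective_pairing [f t]surjective_pairing e2.
by congr (_, _); apply: (cube_inj charK); rewrite (sol_f s) (sol_f t) e2.
Qed.

Lemma rank_uv_eq r (phi : 'rV['F_3]_r -> K * K) :
  injective phi -> (forall w, uv_eq (phi w)) ->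
  [/\ (r <= 4)%N, (a4 * a8 = 1 -> (r <= 3)%N)
    & (a4 * a8 = 1 -> a4 ^+ 3 + a8 = 0 -> (r <= 2)%N)].
Proof.
move=> inj_phi sol_phi; have := card_uv_eq inj_phi sol_phi.
rewrite card_mx card_Fp // mul1n.
rewrite -[81%N]/(3 ^ 4)%N -[27%N]/(3 ^ 3)%N -[9%N]/(3 ^ 2)%N.
by rewrite !leq_exp2l.
Qed.

End Solutions.

Theorem corollary5p2 (k : closedFieldType) (chark : 3%N \in [pchar k])
    (a4 a5 a7 a8 : k)
    (simple_roots : forall x : k, root ((a12 a4 a5 a7 a8)^`()) x ->
       mup x ((a12 a4 a5 a7 a8)^`()) = 1%N) :
  exists r : nat,
    [/\ MW_torsion_rank (a12 a4 a5 a7 a8) r,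
        (r <= 4)%N,
        (a4 * a8 = 1 -> (r <= 3)%N)
      & (a4 * a8 = 1 -> a4 ^+ 3 + a8 = 0 -> (r <= 2)%N)].
Proof.
have charK := pchar_fraction_poly chark.
have noncube := @a12_noncube k a4 a5 a7 a8 chark.
have [|||r phi injphi Sphi|r [phi [inj_phi imP phiD]]] :=
    @elementary_abelian3_coordinates _ (@uv_eq k a4 a5 a7 a8) 4.
- move=> [x y]; rewrite -[LHS]/(x *+ 3, y *+ 3).
  by rewrite !(mulrn_mod3 charK _ 3).
- by rewrite /uv_eq /= !expr0n /= mulr0 subr0.
- by move=> x y; apply: uv_eqD.
- by have [] := rank_uv_eq chark injphi Sphi.
have Sphi w : uv_eq a4 a5 a7 a8 (phi w) by apply/imP; exists w.
exists r; have [r4 r3 r2] := rank_uv_eq chark inj_phi Sphi; split=> //.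
have [psi on_psi uv_psi] : exists2 psi : 'rV['F_3]_r -> _,
    forall w, in_MW (a12 a4 a5 a7 a8) (psi w) & forall w, uv (psi w) = phi w.
  have lift w : exists2 P, in_MW (a12 a4 a5 a7 a8) P & uv P = phi w.
    have [P onP uvP] := uv_surj (Sphi w).
    by exists P => //; rewrite uvP -surjective_pairing.
  by have [psi] := fin_all_exists2 lift; exists psi.
exists psi; split=> [w1 w2 e|P|w1 w2].
- by apply: inj_phi; rewrite -!uv_psi e.
- split=> [onP|[w <-]//].
  have /imP[w phi_w] : uv_eq a4 a5 a7 a8 (uv P) by apply: uv_solution.
  by exists w; apply: (uv_inj noncube (on_psi w) onP); rewrite uv_psi.
have uvD : uv (wadd (psi w1) (psi w2)) = uv (psi (w1 + w2)).
  by rewrite (uv_wadd charK noncube) ?uv_psi ?phiD //; apply: on_psi.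
by apply/esym/(uv_wadd_inj charK noncube) => //; apply: on_psi.
Qed.
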